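(* Let $\chi$ be a non-trivial Dirichlet character of conductor $q$. If there are a constant $C$ and some $r$ with $1/2\le r<1$ such that $$d_r^2\le\frac{1}{2-2r}-\frac{C^2}{2(\log q)^2(1-r)^3},$$ then $L(\chi,\sigma)\neq0$ for all real $\sigma>1-C/\log q$.
   Context: $L(\chi,s)=\sum_{n\ge1}\chi(n)n^{-s}$ is the Dirichlet $L$-function of $\chi$ (continued analytically to $\mathbb{C}$). For $1/2\le r<1$, $$d_r^2=\inf\int_0^1\Big|t^{1-r}-t^r\sum_{j=1}^{\ell}c_j\sum_{n<\alpha_j/t}\chi(n)\Big|^2\frac{dt}{t},$$ the infimum being over all integers $\ell\ge0$, $c=(c_j)\in\mathbb{C}^\ell$ and $\alpha=(\alpha_j)\in(0,1]^\ell$. *)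

(* Defs.v *)
From HB Require Import structures.
From mathcomp Require Import all_boot all_order all_algebra.
From mathcomp Require Import all_classical all_reals all_analysis.
From mathcomp Require Import complex.

Set Implicit Arguments.
Unset Strict Implicit.
Unset Printing Implicit Defensive.

Import Order.TTheory GRing.Theory Num.Theory.
Import numFieldNormedType.Exports.

Local Open Scope classical_set_scope.
Local Open Scope ring_scope.
Local Open Scope complex_scope.

Section DirichletCharacters.
Variable R : realType.
Implicit Types chi psi : nat -> R[i].

(* Characters are represented by their values on the natural numbers, which
   determine them by periodicity. *)
Definition dirichlet_character (N : nat) chi : Prop :=
  [/\ (0 < N)%N,
      chi 1%N = 1,
      forall m n, chi (m * n)%N = chi m * chi n,
      forall n, chi (n + N)%N = chi n &
      forall n, (chi n != 0) = coprime n N].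

Definition principal (N : nat) chi : Prop :=
  forall n, coprime n N -> chi n = 1.

Definition induced_from (N : nat) chi (d : nat) : Prop :=
  (d %| N)%N /\
  exists2 psi, dirichlet_character d psi &
    forall n, coprime n N -> chi n = psi n.

Definition has_conductor (N : nat) chi (q : nat) : Prop :=
  induced_from N chi q /\ forall d, induced_from N chi d -> (q <= d)%N.

End DirichletCharacters.

Section LFunction.
Variable R : realType.
Implicit Types (f L : R[i] -> R[i]) (a s z : R[i]).

Definition cexp z : R[i] :=
  (expR (complex.Re z))%:C *
  (cos (complex.Im z) +i* sin (complex.Im z)).

Definition natpowC (n : nat) s : R[i] := cexp (s * (ln n%:R)%:C).

(* [R[i]^o] carries the topology given by the modulus. *)
Definition analytic_at f a : Prop :=
  exists2 e : R, 0 < e &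
    exists c : nat -> R[i], forall z, Normc.normc (z - a) < e ->
      ((fun n => \sum_(0 <= k < n) c k * (z - a) ^+ k) : nat -> R[i]^o)
        @ \oo --> (f z : R[i]^o).

(* [L] is the analytic continuation of the Dirichlet series of [chi] to the
   whole complex plane; it is unique by the identity theorem, and it exists
   whenever [chi] is a non-principal character. *)
Definition is_dirichlet_L (chi : nat -> R[i]) L : Prop :=
  (forall a, analytic_at L a) /\
  (forall s, 1 < complex.Re s ->
     ((fun n => \sum_(1 <= k < n) chi k * natpowC k (- s)) : nat -> R[i]^o)
       @ \oo --> (L s : R[i]^o)).

End LFunction.

Section Distance.
Variable R : realType.
Implicit Types (chi : nat -> R[i]) (r t x : R).

(* Sum over the [n >= 1] with [n < x]; the index bound only truncates the range
   to the [n] at most equal to the integer part of [x]. *)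
Definition char_sum chi x : R[i] :=
  \sum_(1 <= n < (Num.truncn x).+1 | n%:R < x) chi n.

Definition dist_integrand chi r (l : nat) (c : 'I_l -> R[i])
    (alpha : 'I_l -> R) t : R :=
  Normc.normc ((t `^ (1 - r))%:C
    - (t `^ r)%:C * \sum_(j < l) c j * char_sum chi (alpha j / t)) ^+ 2 / t.

(* The square of d_r, as an extended real. *)
Definition dist_sq chi r : \bar R :=
  ereal_inf [set v : \bar R |
    exists (l : nat) (c : 'I_l -> R[i]) (alpha : 'I_l -> R),
      (forall j, 0 < alpha j <= 1) /\
      v = (\int[@lebesgue_measure R]_(t in (`]0%R, 1%R[%classic : set R))
             (dist_integrand chi r c alpha t)%:E)%E].

End Distance.

(* Main.v *)
Require Import Defs.
From HB Require Import structures.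
From mathcomp Require Import all_boot all_order all_algebra.
From mathcomp Require Import all_classical all_reals all_analysis.
From mathcomp Require Import complex.
From mathcomp Require Import measurable_realfun.
From mathcomp Require Import ring lra.

Set Implicit Arguments.
Unset Strict Implicit.
Unset Printing Implicit Defensive.

Import Order.TTheory GRing.Theory Num.Theory.
Import numFieldNormedType.Exports.

Local Open Scope classical_set_scope.
Local Open Scope ring_scope.
Local Open Scope complex_scope.

(**
  Put S(x) = \sum_(n < x) chi n, which is bounded because a non-principal
  character sums to 0 over a period.  On the real half-line s > 0,

      \int_0^1 t^(s-1) S(alpha / t) dt = alpha^s L(s) / s    (0 < alpha <= 1):

  both sides are real analytic in s and they agree for s > 1.  If L(s) = 0 for
  some r < s <= 1, then t^(s-r) is orthogonal, in L^2((0,1), dt/t), to every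
  t^r S(alpha / t), so projecting on t^(s-r) gives

      d_r^2 >= 2 (s - r) / (1 - 2 r + s)^2
             = 1 / (2 - 2 r) - (1 - s)^2 / ((2 - 2 r) (1 - 2 r + s)^2),

  which contradicts the assumed bound because 1 - 2 r + s > 1 - r.  For
  s <= r the assumed bound is negative.  For s > 1, sieving the Dirichlet series
  by the primes below k multiplies its sum by Euler factors, but for k large it
  leaves a sum close to its first term 1.
*)

(** * Lebesgue integrals over (0, 1) *)

Section UnitIntervalIntegrals.
Variable R : realType.
Implicit Types (f g : R -> R) (a b p s t v : R).

Let mu := @lebesgue_measure R.
Let D : set R := `]0%R, 1%R[.

Let mD : (measurable : set (set (measurableTypeR R))) D.
Proof. exact: measurable_itv. Qed.

(** Integrability and value are bundled so that linear combinations and limits of integrals are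
    computed in [R] instead of the extended reals. *)
Definition has_int f v : Prop :=
  mu.-integrable D (EFin \o f) /\ (\int[mu]_(t in D) (f t)%:E = v%:E)%E.

Lemma integrable_has_int f : mu.-integrable D (EFin \o f) -> exists v, has_int f v.
Proof.
move=> fi; exists (fine (\int[mu]_(t in D) (f t)%:E)%E); split => //.
by rewrite fineK//; exact: integrable_fin_num.
Qed.

Lemma eq_has_int f g v : (forall t, 0 < t < 1 -> f t = g t) ->
  has_int f v -> has_int g v.
Proof.
move=> fg [fi fv]; split.
  by apply: eq_integrable fi => // t; rewrite inE /D /= in_itv/= => /fg ->.
by rewrite -fv; apply: eq_integral => t; rewrite inE /D /= in_itv/= => /fg ->.
Qed.

Lemma has_intD f g v w : has_int f v -> has_int g w ->
  has_int (fun t => f t + g t) (v + w).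
Proof.
move=> [fi fv] [gi gw]; split.
  by have := integrableD mD fi gi; apply: eq_integrable.
under eq_integral do rewrite EFinD.
by rewrite integralD// fv gw.
Qed.

Lemma has_intZ f v k : has_int f v -> has_int (fun t => k * f t) (k * v).
Proof.
move=> [fi fv]; split.
  by have := integrableZl mD k fi; apply: eq_integrable.
under eq_integral do rewrite EFinM.
by rewrite integralZl// fv.
Qed.

Lemma has_int_sum (I : Type) (s : seq I) (P : pred I) (f : I -> R -> R)
    (v : I -> R) : (forall i, has_int (f i) (v i)) ->
  has_int (fun t => \sum_(i <- s | P i) f i t) (\sum_(i <- s | P i) v i).
Proof.
move=> fv; split.
  have := @integrable_sum _ _ _ mu D mD I s P (fun i => EFin \o f i)
    (fun i _ => (fv i).1).
  by apply: eq_integrable => // t _ /=; rewrite sumEFin.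
under eq_integral do rewrite -sumEFin.
rewrite integral_sum//; last by move=> i; exact: (fv i).1.
by rewrite -sumEFin; apply: eq_bigr => i _; exact: (fv i).2.
Qed.

Lemma has_int_uniq f v w : has_int f v -> has_int f w -> v = w.
Proof. by move=> [_ fv] [_]; rewrite fv => -[]. Qed.

Lemma has_int_dominated (f_ : nat -> R -> R) (v_ : nat -> R) f g w :
  (forall n, has_int (f_ n) (v_ n)) ->
  (forall t, 0 < t < 1 -> (fun n => f_ n t) @ \oo --> f t) ->
  has_int g w -> (forall n t, 0 < t < 1 -> `|f_ n t| <= g t) ->
  exists2 v, has_int f v & v_ @ \oo --> v.
Proof.
move=> fv ff [gi _] fg.
have mf n : measurable_fun D (EFin \o f_ n).
  by have /integrableP[] := (fv n).1.
have mf_ n : measurable_fun D (f_ n) by exact/measurable_EFinP.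
have mlim : measurable_fun D (EFin \o f).
  apply/measurable_EFinP; apply: (measurable_fun_cvg mf_) => t.
  by rewrite /D /= in_itv/=; exact: ff.
have [|||fi _ fl] := @dominated_convergence _ _ _ mu D mD (fun n => EFin \o f_ n)
    (EFin \o f) (EFin \o g) mf mlim.
- apply: aeW => t; rewrite /D /= in_itv/= => t01.
  by apply: cvg_EFin; [exact: nearW|exact: ff].
- exact: gi.
- apply: aeW => t n; rewrite /D /= in_itv/= => t01.
  by rewrite lee_fin fg.
have [v fiv] := integrable_has_int fi.
exists v => //; suff : (EFin \o v_) @ \oo --> v%:E by exact: fine_cvg.
have -> : EFin \o v_ = (fun n => \int[mu]_(x in D) (f_ n x)%:E)%E.
  by apply/funext => n /=; rewrite (fv n).2.
by rewrite -fiv.2; exact: fl.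
Qed.

(** The integral of [f] may be infinite and [g] may change sign, so the comparison passes through
    the positive part: [g <= max(g, 0) <= f]. *)
Lemma has_int_ge_lbound f g v : has_int g v ->
  measurable_fun D f -> (forall t, 0 < t < 1 -> 0 <= f t) ->
  (forall t, 0 < t < 1 -> g t <= f t) ->
  (v%:E <= \int[mu]_(t in D) (f t)%:E)%E.
Proof.
move=> [gi <-] mf f0 gf.
have mg : measurable_fun D g by apply/measurable_EFinP; case/integrableP : gi.
apply: (@le_trans _ _ (\int[mu]_(t in D) (Num.max (g t) 0)%:E)%E).
  apply: le_integral => //.
    apply: le_integrable gi => //.
      by apply/measurable_EFinP; exact: measurable_maxr.
    move=> t _ /=; rewrite lee_fin; have [|] := leP (g t) 0 => //.
    by rewrite normr0.
  by move=> t _; rewrite lee_fin le_max lexx.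
apply: ge0_le_integral => //.
- by move=> t _; rewrite lee_fin le_max lexx orbT.
- by apply/measurable_EFinP; exact: measurable_maxr.
- exact/measurable_EFinP.
- by move=> t; rewrite /D /= in_itv/= => t01; rewrite lee_fin ge_max gf// f0.
Qed.

(** For [p < 1] the power is singular at 0, so the fundamental theorem of calculus is applied on
    [[b/(n+1), b]] and the integrals over these increasing sets are passed to the limit. *)
Lemma has_int_powR p b : 0 < p -> 0 < b <= 1 ->
  has_int (fun t => if t < b then t `^ (p - 1) else 0) (b `^ p / p).
Proof.
move=> p0 /andP[b0 b1].
set h := fun t : R => t `^ (p - 1).
have mh (A : set R) : measurable A -> measurable_fun A (EFin \o h).
  move=> mA; apply/measurable_EFinP; apply: measurable_funS (measurable_powR _) => //.
pose u n : R := b / n.+1%:R.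
have u0 n : 0 < u n by rewrite divr_gt0.
pose F n := [set` `[u n, b]] : set R.
have FE : \bigcup_n F n = [set` `]0, b]].
  apply/seteqP; split => t /=.
    move=> [n _]; rewrite /F /= !in_itv/= => /andP[ut ->]; rewrite andbT.
    exact: lt_le_trans ut.
  rewrite in_itv/= => /andP[t0 tb].
  exists (Num.truncn (b / t)) => //; rewrite /F /= in_itv/= tb andbT /u.
  by rewrite ler_pdivrMr// mulrC -ler_pdivrMr// ltW// truncnS_gt.
have IF n : (\int[mu]_(t in F n) (h t)%:E = (b `^ p / p - u n `^ p / p)%:E)%E.
  have [->|n0] := eqVneq n 0%N.
    rewrite /F /u divr1 set_itv1 integral_set1 subrr//.
  have ub : u n < b.
    rewrite /u ltr_pdivrMr// ltr_pMr// ltr1n ltnS lt0n//.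
  have := @continuous_FTC2 R h (fun x => x `^ p / p) (u n) b ub.
  rewrite /F EFinB; apply.
  - apply: derivable_within_continuous => x; rewrite in_itv/= => /andP[ux _].
    apply: derivable_powR; rewrite in_itv/= andbT; exact: lt_le_trans ux.
  - have dP (x : R) : 0 < x -> {for x, continuous (fun x : R => x `^ p / p)}.
      move=> x0; apply: cvgMl.
      have : derivable ((@powR R)^~ p) x 1.
        by apply: derivable_powR; rewrite in_itv/= andbT.
      by move=> /derivable1_diffP/differentiable_continuous.
    split.
    + move=> x; rewrite in_itv/= => /andP[ux _]; apply: derivableM => //.
      by apply: derivable_powR; rewrite in_itv/= andbT (lt_trans _ ux).
    + by apply: cvg_at_right_filter; exact: dP.
    + by apply: cvg_at_left_filter; exact: dP.
  - move=> x; rewrite in_itv/= => /andP[ux _].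
    have x0 : 0 < x by exact: lt_trans ux.
    rewrite derive1Mr; last by apply: derivable_powR; rewrite in_itv/= andbT.
    rewrite powR_derive1 ?in_itv/= ?andbT// /h mulrAC divff ?mul1r// gt_eqF//.
have c1 : (\int[mu]_(t in F n) (h t)%:E)%E @[n --> \oo] --> (b `^ p / p)%:E.
  under eq_fun do rewrite IF.
  apply: cvg_EFin; first exact: nearW.
  rewrite -[X in _ --> X]subr0; apply: cvgB; first exact: cvg_cst.
  rewrite -[X in _ --> X](mul0r p^-1); apply: cvgMl.
  have /cvg_at_rightP := powR_cvg0 p0; apply; split=> //.
  rewrite -[X in _ --> X](mulr0 b); apply: cvgMr; exact: cvg_harmonic.
have c2 : (\int[mu]_(t in F n) (EFin \o h) t)%E @[n --> \oo] -->
    (\int[mu]_(t in \bigcup_n F n) (EFin \o h) t)%E.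
  apply: ge0_nondecreasing_set_cvg_integral.
  - move=> m n mn; rewrite subsetEset => t /=.
    rewrite /F /= !in_itv/= => /andP[+ ->]; rewrite andbT; apply: le_trans.
    by rewrite /u ler_pM2l// lef_pV2 ?posrE// ler_nat ltnS.
  - by move=> n; exact: measurable_itv.
  - by move=> n; apply: mh; exact: measurable_itv.
  - by move=> n t _; rewrite /= lee_fin powR_ge0.
have I : (\int[mu]_(t in `]0%R, b]) (h t)%:E = (b `^ p / p)%:E)%E.
  by rewrite -FE; apply/esym; apply: cvg_unique c1 c2.
have J : (\int[mu]_(t in D) (if t < b then h t else 0)%:E = (b `^ p / p)%:E)%E.
  rewrite -I -integral_itv_bndo_bndc; last exact: mh.
  have -> : `]0, b[%classic = `]-oo, b[%classic `&` D.
    apply/seteqP; split => t; rewrite /D /= !in_itv/=.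
      by move=> /andP[-> tb]; rewrite tb (lt_le_trans tb).
    by move=> [-> /andP[->]].
  rewrite integral_mkcondl; apply: eq_integral => t _.
  rewrite patchE; case: ifPn => [tb|tb].
    by rewrite mem_set//= in_itv.
  by rewrite memNset//= in_itv/=; exact/negP.
split=> //; apply/integrableP; split.
  apply/measurable_EFinP; apply: (@measurable_funS _ _ _ _ setT) => //.
  by apply: measurable_fun_ifT => //; exact: measurable_fun_ltr.
rewrite (_ : integral _ _ _ = (b `^ p / p)%:E) ?ltry// -J.
apply: eq_integral => t _ /=.
by rewrite ger0_norm//; case: ifP => // _; exact: powR_ge0.
Qed.

End UnitIntervalIntegrals.

(** * Real analytic functions and the identity theorem on the positive half-line *)

Section RealAnalytic.
Variable R : realType.
Implicit Types (h g : R -> R) (c : nat -> R) (a e x y : R).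

Definition real_analytic_at h a : Prop :=
  exists2 e, 0 < e & exists c, forall x, `|x - a| < e ->
    (fun n => \sum_(0 <= k < n) c k * (x - a) ^+ k) @ \oo --> h x.

Lemma real_analytic_atB h g a : real_analytic_at h a -> real_analytic_at g a ->
  real_analytic_at (fun x => h x - g x) a.
Proof.
move=> [e e0 [c hc]] [e' e'0 [c' gc']].
exists (Num.min e e'); first by rewrite lt_min e0.
exists (fun k => c k - c' k) => x; rewrite lt_min => /andP[xe xe'].
rewrite (_ : (fun n => _) = (fun n => \sum_(0 <= k < n) c k * (x - a) ^+ k
    - \sum_(0 <= k < n) c' k * (x - a) ^+ k)).
  by apply: cvgB; [exact: hc|exact: gc'].
apply/funext => n; rewrite -sumrB; apply: eq_bigr => k _.
by rewrite mulrBl.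
Qed.

(** Writing [x = a + (x - a)] turns the coefficients [c_k] into [a c_k + c_(k-1)]. *)
Lemma real_analytic_at_idM h a : real_analytic_at h a ->
  real_analytic_at (fun x => x * h x) a.
Proof.
move=> [e e0 [c hc]]; exists e => //.
exists (fun k => a * c k + (if k is k'.+1 then c k' else 0)) => x xe.
pose P n := \sum_(0 <= k < n) c k * (x - a) ^+ k.
have cP : P @ \oo --> h x := hc _ xe.
have c0 : (fun n => c n * (x - a) ^+ n) @ \oo --> (0 : R).
  by apply: cvg_series_cvg_0; apply: cvgP cP.
rewrite -cvg_shiftS /=.
rewrite (_ : (fun n => _) = (fun n => a * P n.+1 + (x - a) * P n)); last first.
  apply/funext => n; rewrite {2}/P.
  under eq_bigr do rewrite mulrDl.
  rewrite big_split/=; congr (_ + _).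
    by rewrite mulr_sumr; apply: eq_bigr => k _; rewrite mulrA.
  rewrite big_nat_recl//= mul0r add0r mulr_sumr.
  by apply: eq_bigr => k _; rewrite exprS mulrCA.
have -> : x * h x = a * h x + (x - a) * h x by ring.
apply: cvgD; apply: cvgMr => //.
by rewrite (cvg_shiftS P).
Qed.

(** Only points [x > 0] are available, so [x = 0] cannot be substituted. The terms at a fixed [y]
    are bounded by [M]; at [q y] with [q <= 1/2] the terms of positive degree sum to at most
    [2 M q], which bounds [|c 0|] and tends to 0 with [q]. *)
Lemma power_series0_coef0 c e : 0 < e ->
  (forall x, 0 < x < e -> (fun n => \sum_(0 <= k < n) c k * x ^+ k) @ \oo --> 0) ->
  c 0%N = 0.
Proof.
move=> e0 c_0.
pose y := e / 2.
have y0 : 0 < y by rewrite divr_gt0.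
have ye : y < e by rewrite /y; lra.
have [M M0 cM] : exists2 M, 0 < M & forall k, `|c k| * y ^+ k <= M.
  have : cvgn (series (fun k => c k * y ^+ k)).
    by apply: cvgP; apply: c_0; rewrite y0.
  move=> /cvg_series_bounded[M [_ /(_ (`|M| + 1))]] b.
  exists (`|M| + 1); first by rewrite ltr_wpDl.
  have M1 : M < `|M| + 1 by rewrite (le_lt_trans (ler_norm M))// ltrDl.
  by move=> k; have := b M1 k I; rewrite /= normrM (ger0_norm (exprn_ge0 _ (ltW y0))).
have le q : 0 < q <= 2^-1 -> `|c 0%N| <= 2 * M * q.
  move=> /andP[q0 q2].
  have xb : 0 < q * y < e.
    rewrite mulr_gt0//= (le_lt_trans _ ye)// ger_pMl//; lra.
  have := c_0 _ xb; rewrite -cvg_shiftS => cx.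
  have {cx} : (fun n => \sum_(0 <= k < n) c k.+1 * (q * y) ^+ k.+1) @ \oo
      --> - c 0%N.
    rewrite -[X in _ --> X]add0r.
    rewrite (_ : (fun n => _) =
      (fun n => \sum_(0 <= k < n.+1) c k * (q * y) ^+ k - c 0%N)).
      by apply: cvgB => //; exact: cvg_cst.
    by apply/funext => n; rewrite big_nat_recl// expr0 mulr1 addrAC subrr add0r.
  move=> /cvg_norm; rewrite normrN => cx.
  have cc : (fun=> 2 * M * q : R) @ \oo --> 2 * M * q by exact: cvg_cst.
  apply: (ler_cvg_to cx cc).
  apply: nearW => n; apply: (le_trans (ler_norm_sum _ _ _)).
  have E : \sum_(0 <= k < n) M * q ^+ k.+1 <= 2 * M * q.
    have -> : \sum_(0 <= k < n) M * q ^+ k.+1 = M * q * \sum_(k < n) q ^+ k.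
      rewrite big_mkord mulr_sumr; apply: eq_bigr => k _.
      by rewrite exprS mulrA.
    have -> : 2 * M * q = M * q * 2 by ring.
    rewrite ler_pM2l ?mulr_gt0//.
    have := subrX1 q n; have : 0 <= q ^+ n by rewrite exprn_ge0// ltW.
    have : 0 <= \sum_(k < n) q ^+ k by rewrite sumr_ge0// => k _; rewrite exprn_ge0// ltW.
    nra.
  apply: le_trans E; apply: ler_sum => k _.
  rewrite normrM normrX normrM (gtr0_norm q0) (gtr0_norm y0) exprMn mulrCA mulrC.
  by rewrite ler_wpM2r// exprn_ge0// ltW.
apply/eqP; rewrite -normr_le0; apply/ler_addgt0Pr => d d0; rewrite add0r.
pose q := Num.min 2^-1 (d / (2 * M)).
have q0 : 0 < q by rewrite lt_min invr_gt0 ltr0n divr_gt0// mulr_gt0.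
apply: (le_trans (le q _)); first by rewrite q0 ge_min lexx.
by rewrite mulrC -ler_pdivlMr ?mulr_gt0// ge_min lexx orbT.
Qed.

(** Once the constant term is 0, dividing by [x > 0] shifts the coefficients by one, which drives an
    induction on [k] for all [c] at once. *)
Lemma power_series0_coef c e : 0 < e ->
  (forall x, 0 < x < e -> (fun n => \sum_(0 <= k < n) c k * x ^+ k) @ \oo --> 0) ->
  forall k, c k = 0.
Proof.
move=> e0 c_0 k; elim: k c c_0 => [|k IH] c c_0; first exact: power_series0_coef0 c_0.
apply: (IH (fun k => c k.+1)) => x xe.
have c00 := power_series0_coef0 e0 c_0.
have x0 : x != 0 by rewrite gt_eqF//; case/andP : xe.
rewrite (_ : (fun n => _) = (fun n => x^-1 * \sum_(0 <= k < n.+1) c k * x ^+ k)).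
  rewrite -[X in _ --> X](mulr0 x^-1); apply: cvgMr.
  by have := c_0 _ xe; rewrite -cvg_shiftS.
apply/funext => n; rewrite big_nat_recl// c00 mul0r add0r mulr_sumr.
by apply: eq_bigr => i _; rewrite exprS mulrCA mulKf.
Qed.

(** Let [a] be the infimum of the [z > 0] to the right of which [h] vanishes; a point [x > 0] with
    [h x <> 0] forces [a >= x]. The expansion at [a] vanishes to the right of [a], so all its
    coefficients do, and [h] is zero slightly to the left of [a] as well, against minimality. *)
Lemma real_analytic_identity h b :
  (forall a, 0 < a -> real_analytic_at h a) -> (forall x, b < x -> h x = 0) ->
  forall x, 0 < x -> h x = 0.
Proof.
move=> ha hb x x0.
pose A : set R := [set z | 0 < z /\ forall y, z < y -> h y = 0].
apply: contrapT => hx.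
have lbA : lbound A x.
  by move=> z [_ Az]; rewrite leNgt; apply/negP => zx; exact/hx/Az.
have nA : A (Num.max b 1).
  split; first by rewrite lt_max ltr01 orbT.
  by move=> y; rewrite gt_max => /andP[by_ _]; exact: hb.
have iA : has_inf A by split; [exists (Num.max b 1)|exists x].
set a := inf A.
have xa : x <= a by apply: lb_le_inf => //; exists (Num.max b 1).
have a0 : 0 < a by exact: lt_le_trans xa.
have hgt y : a < y -> h y = 0.
  move=> ay; have ya : 0 < y - a by rewrite subr_gt0.
  have [z [_ Az] zy] := inf_adherent ya iA.
  by apply: Az; move: zy; rewrite addrC subrK.
have [e e0 [c hc]] := ha _ a0.
have c0 : forall k, c k = 0.
  apply: (power_series0_coef e0) => y /andP[y0 ye].
  have := hc (a + y); rewrite addrAC subrr add0r gtr0_norm// => /(_ ye).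
  by rewrite hgt// ltrDl.
have hnear y : `|y - a| < e -> h y = 0.
  move=> ye; have := hc _ ye.
  rewrite (_ : (fun n => _) = cst 0); last first.
    by apply/funext => n; rewrite big1// => k _; rewrite c0 mul0r.
  by move=> H; apply/esym; apply: cvg_unique H => //; exact: cvg_cst.
(* [a / 2] keeps [z] positive, and [a - e / 2] keeps []z, a]] where the expansion is valid. *)
pose z := Num.max (a / 2) (a - e / 2).
have za : z < a by rewrite gt_max; apply/andP; split; lra.
have : A z.
  split; first by rewrite lt_max divr_gt0.
  move=> y; rewrite gt_max => /andP[y1 y2].
  have [ay|ya] := ltP a y; first exact: hgt.
  by apply: hnear; rewrite distrC ger0_norm ?subr_ge0//; lra.
by move/(ge_inf iA.2); rewrite leNgt za.
Qed.

End RealAnalytic.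

(** * Analyticity of Mellin integrals over (0, 1) *)

Section MellinAnalytic.
Variable R : realType.
Implicit Types (f g : R -> R) (a e x y t : R).

Let D : set R := `]0%R, 1%R[.

Lemma has_int_measurable f v : has_int f v -> measurable_fun D f.
Proof. by case=> /integrableP[/measurable_EFinP]. Qed.

Lemma has_int_le f g w : measurable_fun D f -> has_int g w ->
  (forall t, 0 < t < 1 -> `|f t| <= g t) -> exists v, has_int f v.
Proof.
move=> mf [gi _] fg; apply: integrable_has_int.
apply: le_integrable gi; first exact: measurable_itv.
  exact/measurable_EFinP.
move=> t; rewrite /= in_itv/= => t01; rewrite lee_fin.
by rewrite (le_trans (fg _ t01))// ler_norm.
Qed.

Lemma has_int_powR1 (p : R) : 0 < p -> has_int (fun t => t `^ (p - 1)) p^-1.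
Proof.
move=> p0; have := @has_int_powR R p 1 p0; rewrite ltr01 lexx powR1 div1r.
move=> /(_ isT); apply: eq_has_int => t /andP[_ ->] //.
Qed.

Lemma exp_coeff_sum_le x n : 0 <= x ->
  \sum_(0 <= k < n) exp_coeff x k <= expR x.
Proof.
move=> x0; apply: (@nondecreasing_cvgn_le _ (series (exp_coeff x))).
  by apply: nondecreasing_series => k _ _; exact: exp_coeff_ge0.
exact: is_cvg_series_exp_coeff.
Qed.

Lemma exp_coeff_sum_norm_le x n :
  `|\sum_(0 <= k < n) exp_coeff x k| <= expR `|x|.
Proof.
apply: le_trans (exp_coeff_sum_le n (normr_ge0 x)).
apply: le_trans (ler_norm_sum _ _ _) _; apply: ler_sum => k _.
by rewrite /exp_coeff /= normrM normrX normfV (ger0_norm (ler0n _ _)).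
Qed.

Lemma exp_coeff_norm_le x k : `|exp_coeff x k| <= expR `|x|.
Proof.
apply: le_trans (exp_coeff_sum_le k.+1 (normr_ge0 x)).
rewrite big_nat_recr//= /exp_coeff /= normrM normrX normfV (ger0_norm (ler0n _ _)).
by rewrite lerDr sumr_ge0// => i _; rewrite divr_ge0// exprn_ge0.
Qed.

(* The Taylor coefficients at a are \int f t^(a-1) (ln t)^k / k!. *)
Lemma mellin_analytic f (G : R -> R) (B : R) :
  (forall s, 0 < s -> has_int (fun t => f t * t `^ (s - 1)) (G s)) ->
  (forall t, `|f t| <= B) -> forall a, 0 < a -> real_analytic_at G a.
Proof.
move=> fG fB a a0.
have B0 : 0 <= B by exact: le_trans (fB 0).
(* With radius [a / 2], all Taylor sums are dominated by [B t^(a - 1 - y) = B t^(y - 1)], which is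
   integrable. *)
pose y := a / 2.
have y0 : 0 < y by rewrite divr_gt0.
exists y => //.
have mf : measurable_fun D (fun t => f t * t `^ (a - 1)).
  exact: has_int_measurable (fG _ a0).
have dom x t : `|x| <= y -> 0 < t < 1 -> expR `|x * ln t| * t `^ (a - 1) <= t `^ (y - 1).
  move=> xy /andP[t0 t1].
  have -> : y - 1 = - y + (a - 1) by rewrite /y; field.
  rewrite (@powRD _ t (- y) (a - 1)); last by rewrite (gt_eqF t0) implybT.
  apply: ler_wpM2r; first exact: powR_ge0.
  rewrite /powR gt_eqF// ler_expR normrM mulNr -mulrN.
  by rewrite (ltr0_norm (ln_lt0 _)) ?t0// ler_wpM2r// oppr_ge0 ln_le0// ltW.
have [w wP] : exists w, has_int (fun t => B * t `^ (y - 1)) w.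
  by exists (B * y^-1); apply: has_intZ; exact: has_int_powR1.
(* Integrating with [y ln t] in place of [ln t] keeps every term under the common dominating
   function; dividing by [y ^+ k] afterwards removes the scale. *)
have coef k : exists v,
    has_int (fun t => f t * t `^ (a - 1) * exp_coeff (y * ln t) k) v.
  apply: has_int_le wP _.
    apply: measurable_funM => //; apply: measurable_funM => //.
    apply: measurable_funX; apply: measurable_funM => //.
    by apply: (@measurable_funS _ _ _ _ setT) => //; exact: measurable_ln.
  move=> t t01; rewrite normrM normrM -mulrA ler_pM//.
  rewrite (ger0_norm (powR_ge0 _ _)) mulrC.
  apply: le_trans (dom y t _ t01); last by rewrite gtr0_norm.
  by apply: ler_wpM2r; [exact: powR_ge0|exact: exp_coeff_norm_le].
have [c' cP] := choice coef.
exists (fun k => c' k / y ^+ k) => x xa.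
have E n : has_int (fun t => f t * t `^ (a - 1) *
      \sum_(0 <= k < n) exp_coeff ((x - a) * ln t) k)
    (\sum_(0 <= k < n) c' k / y ^+ k * (x - a) ^+ k).
  have := @has_int_sum R _ (index_iota 0 n) xpredT _ _
    (fun k => has_intZ (((x - a) / y) ^+ k) (cP k)).
  have -> : \sum_(0 <= k < n) ((x - a) / y) ^+ k * c' k =
      \sum_(0 <= k < n) c' k / y ^+ k * (x - a) ^+ k.
    by apply: eq_bigr => k _; rewrite exprMn exprVn mulrC mulrA mulrAC.
  apply: eq_has_int => t _; rewrite mulr_sumr; apply: eq_bigr => k _.
  rewrite mulrCA; congr (_ * _); rewrite /exp_coeff /= mulrA -exprMn mulrA.
  by rewrite divfK// gt_eqF.
have [|n t t01|v v1 v2] := has_int_dominated E _ wP _ (f := fun t => f t * t `^ (x - 1)).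
- move=> t /andP[t0 _].
  have -> : f t * t `^ (x - 1) = f t * t `^ (a - 1) * expR ((x - a) * ln t).
    rewrite -mulrA; congr (_ * _); rewrite /powR gt_eqF// -expRD; congr expR; ring.
  by apply: cvgMr; exact: is_cvg_series_exp_coeff.
- rewrite normrM normrM -mulrA ler_pM//.
  rewrite (ger0_norm (powR_ge0 _ _)) mulrC.
  apply: le_trans (dom (x - a) t (ltW xa) t01).
  by apply: ler_wpM2r; [exact: powR_ge0|exact: exp_coeff_sum_norm_le].
have x0 : 0 < x by move: xa; rewrite /y ltr_norml => /andP[]; lra.
by rewrite (has_int_uniq (fG _ x0) v1).
Qed.

End MellinAnalytic.

(** * Step functions of partial sums and their Mellin integrals *)

Section StepSums.
Variable R : realType.
Implicit Types (w : nat -> R) (B s t x alpha : R).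

Definition step_sum w x : R :=
  \sum_(1 <= n < (Num.truncn x).+1 | n%:R < x) w n.

(** The cut is the ceiling of [x], or 0 for [x <= 0]; it converts the strict real inequality into a
    range of indices, integer [x] included. *)
Lemma natr_lt_cut x : exists m, forall k : nat, (k%:R < x) = (k < m)%N.
Proof.
have ex : exists k : nat, x <= k%:R by exists (Num.truncn x).+1; rewrite ltW ?truncnS_gt.
case: (ex_minnP ex) => m xm mmin; exists m => k.
apply/idP/idP => [kx|]; first by rewrite -(ltr_nat R) (lt_le_trans kx).
by move=> km; rewrite ltNge; apply/negP => /mmin; rewrite leqNgt km.
Qed.

Lemma sum_ltn_cut w n m :
  \sum_(1 <= k < n | (k < m)%N) w k = \sum_(1 <= k < minn n m) w k.
Proof.
case: leqP => [nm|mn]; last by rewrite [RHS](big_nat_widen _ _ n)// ltnW.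
by apply: congr_big_nat => // k /andP[_ kn]; rewrite (leq_trans kn nm).
Qed.

Lemma step_sum_cut w x m : (forall k : nat, (k%:R < x) = (k < m)%N) ->
  step_sum w x = \sum_(1 <= k < m) w k.
Proof.
move=> mP; rewrite /step_sum; under eq_bigl do rewrite mP.
rewrite sum_ltn_cut (minn_idPr _)// leqNgt -mP -leNgt ltW ?truncnS_gt//.
Qed.

Lemma step_sum_le w B x : (forall n, `|\sum_(1 <= k < n) w k| <= B) ->
  `|step_sum w x| <= B.
Proof. by move=> wB; have [m mP] := natr_lt_cut x; rewrite (step_sum_cut w mP). Qed.

(* Each term integrates to w k (alpha/k)^s / s by [has_int_powR]; bounded partial
   sums of w make the truncations of [step_sum] a dominated sequence, which also
   gives the convergence of the Dirichlet series for all s > 0. *)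
Lemma step_sum_mellin w B alpha s :
  (forall n, `|\sum_(1 <= k < n) w k| <= B) -> 0 < alpha <= 1 -> 0 < s ->
  exists2 v, has_int (fun t => step_sum w (alpha / t) * t `^ (s - 1)) v &
    (fun n => \sum_(1 <= k < n) w k * ((alpha / k%:R) `^ s / s)) @ \oo --> v.
Proof.
move=> wB /andP[a0 a1] s0.
pose F (k : nat) t := w k * (if t < alpha / k%:R then t `^ (s - 1) else 0).
have FE n t : 0 < t < 1 -> \sum_(0 <= k < n) F k.+1 t =
    (\sum_(1 <= k < n.+1 | k%:R < alpha / t) w k) * t `^ (s - 1).
  move=> /andP[t0 t1]; rewrite -(big_add1 _ _ 0 n.+1 xpredT (fun k => F k t)).
  rewrite [in RHS]big_mkcond mulr_suml; apply: eq_big_nat => k /andP[k0 _].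
  rewrite /F !ltr_pdivlMr ?ltr0n// mulrC.
  by rewrite (mulrC k%:R); case: ifP => _; rewrite ?mul0r ?mulr0 // mulrC.
have FI n : has_int (fun t => \sum_(0 <= k < n) F k.+1 t)
    (\sum_(0 <= k < n) w k.+1 * ((alpha / k.+1%:R) `^ s / s)).
  apply: has_int_sum => k; apply: has_intZ; apply: has_int_powR => //.
  rewrite divr_gt0//= ler_pdivrMr// mul1r (le_trans a1)// ler1n//.
have [||v v1 v2] := has_int_dominated FI _ (has_intZ B (has_int_powR1 s0)) _
    (f := fun t => step_sum w (alpha / t) * t `^ (s - 1)).
- move=> t t01; have [m mP] := natr_lt_cut (alpha / t).
  rewrite (step_sum_cut w mP); apply: cvg_near_cst; exists m => // n /= mn.
  rewrite FE//; congr (_ * _); rewrite (eq_bigl _ _ mP).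
  by rewrite sum_ltn_cut (minn_idPr _)// leqW.
(* A truncated step sum is again a partial sum of [w], hence bounded by [B] uniformly in [n]. *)
- move=> n t t01; rewrite FE// normrM (ger0_norm (powR_ge0 _ _)).
  apply: ler_wpM2r; first exact: powR_ge0.
  have [m mP] := natr_lt_cut (alpha / t).
  by rewrite (eq_bigl _ _ mP) sum_ltn_cut.
exists v => //; rewrite -cvg_shiftS/=.
by under eq_fun do rewrite big_add1/=.
Qed.

(** Termwise [(alpha / k)^s = alpha^s (1 / k)^s], so the limits of the two series are proportional.
    An integral that vanishes for [alpha = 1] thus vanishes for every [alpha]. *)
Lemma step_sum_mellin_scale w B s v0 alpha :
  (forall n, `|\sum_(1 <= k < n) w k| <= B) -> 0 < alpha <= 1 -> 0 < s ->
  has_int (fun t => step_sum w (1 / t) * t `^ (s - 1)) v0 ->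
  has_int (fun t => step_sum w (alpha / t) * t `^ (s - 1)) (alpha `^ s * v0).
Proof.
move=> wB a01 s0 h0.
have [v hv cv] := step_sum_mellin wB a01 s0.
have [|v1 hv1 cv1] := @step_sum_mellin w B 1 s wB _ s0; first by rewrite ltr01 lexx.
suff -> : alpha `^ s * v0 = v by [].
rewrite (has_int_uniq h0 hv1).
have : (fun n => alpha `^ s * \sum_(1 <= k < n) w k * ((1 / k%:R) `^ s / s))
    @ \oo --> alpha `^ s * v1 by exact: cvgMr.
rewrite (_ : (fun n => _) = fun n => \sum_(1 <= k < n) w k * ((alpha / k%:R) `^ s / s)).
  by move=> cv2; apply: cvg_unique cv2 cv.
apply/funext => n; rewrite mulr_sumr; apply: eq_big_nat => k /andP[k0 _].
rewrite mulrCA; congr (_ * _); rewrite mulrA -powRM ?divr_ge0//.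
  by rewrite mulrA mulr1.
by case/andP : a01 => /ltW.
Qed.

End StepSums.

(** * Character sums over a period *)

Section CharacterSums.
Variable R : realType.

Lemma periodic_modn (T : Type) (w : nat -> T) N :
  (forall n, w (n + N)%N = w n) -> forall n, w n = w (n %% N)%N.
Proof.
move=> wN n; rewrite {1}(divn_eq n N) addnC; elim: (n %/ N)%N => [|d IH].
  by rewrite mul0n addn0.
by rewrite mulSn (addnC N) addnA wN.
Qed.

(** A full period sums to 0, so the initial sums [P] inherit the period [N] and take finitely many
    values; [|w 0|] corrects for the sum starting at 1. *)
Lemma periodic_sum_bounded (w : nat -> R) (N : nat) : (0 < N)%N ->
  (forall n, w (n + N)%N = w n) -> \sum_(0 <= k < N) w k = 0 ->
  exists B, forall n, `|\sum_(1 <= k < n) w k| <= B.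
Proof.
move=> N0 wN w0.
pose P n := \sum_(0 <= k < n) w k.
have PN n : P (n + N)%N = P n.
  elim: n => [|n IH]; first by rewrite add0n /P w0 big_geq.
  by rewrite addSn /P !big_nat_recr//= -!/(P _) IH wN.
have Pmod := periodic_modn PN.
exists (`|w 0%N| + \sum_(i < N) `|P i|) => -[|n].
  by rewrite big_geq// normr0 addr_ge0// sumr_ge0.
have -> : \sum_(1 <= k < n.+1) w k = P n.+1 - w 0%N.
  by rewrite big_add1/= /P big_nat_recl// addrAC subrr add0r.
apply: (le_trans (ler_normB _ _)); rewrite addrC lerD2l Pmod.
have lt : (n.+1 %% N < N)%N by rewrite ltn_mod.
by rewrite (bigD1 (Ordinal lt))//= lerDl sumr_ge0.
Qed.

(** For [m] coprime to [N] with [chi m <> 1], multiplication by [m] permutes the residues modulo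
    [N], whence [S = chi m * S]. *)
Lemma dirichlet_character_sum0 N (chi : nat -> R[i]) :
  dirichlet_character N chi -> ~ principal N chi ->
  \sum_(0 <= k < N) chi k = 0.
Proof.
move=> [N0 _ chiM chiN _] npr.
have [m /not_implyP[mN chim]] : exists m, ~ (coprime m N -> chi m = 1).
  by apply/existsNP.
have chi_mod := periodic_modn chiN.
rewrite big_mkord; set S := \sum_(i < N) _.
pose f (i : 'I_N) := Ordinal (ltn_pmod (m * i) N0).
have f_inj : injective f.
  move=> i j /(congr1 val) /= /eqP; wlog ij : i j / (i <= j)%N.
    by move=> H; case/orP: (leq_total i j) => /H // h e; apply/esym/h; rewrite eq_sym.
  rewrite eq_sym eqn_mod_dvd ?leq_mul2l ?ij ?orbT// -mulnBr Gauss_dvdr; last first.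
    by rewrite coprime_sym.
  rewrite /dvdn modn_small; last by rewrite (leq_ltn_trans (leq_subr _ _)).
  by rewrite subn_eq0 => ji; apply/val_inj/eqP; rewrite eqn_leq ij.
have : S = chi m * S.
  rewrite {1}/S (reindex_inj f_inj)/= mulr_sumr; apply: eq_bigr => i _.
  by rewrite -chi_mod chiM.
move=> /eqP; rewrite -subr_eq0 -{1}(mul1r S) -mulrBl mulf_eq0 subr_eq0 => /orP[|/eqP//].
by move=> /eqP /esym.
Qed.

End CharacterSums.

(** * The L-function on the real axis as a Mellin integral *)

Section RealAxis.
Variable R : realType.
Implicit Types (chi : nat -> R[i]) (L : R[i] -> R[i]) (s x : R).

Lemma normc_real x : Normc.normc x%:C = `|x|.
Proof. by rewrite /= expr0n/= addr0 sqrtr_sqr. Qed.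

Lemma natpowC_real (k : nat) s : (0 < k)%N ->
  natpowC k (- s%:C) = (k%:R `^ (- s))%:C.
Proof.
move=> k0; rewrite /natpowC.
have -> : - s%:C * (ln k%:R)%:C = (- s * ln k%:R)%:C :> R[i].
  by rewrite -rmorphN -rmorphM.
rewrite /cexp /= cos0 sin0 /powR gt_eqF ?ltr0n//.
by rewrite mulr1.
Qed.

(** [rho] stands for the real or the imaginary part; both cases reduce to real functions of a real
    variable. *)
Variable rho : {additive R[i] -> R}.
Hypothesis rhoZ : forall (z : R[i]) x, rho (z * x%:C) = rho z * x.
Hypothesis rho_le : forall z, `|rho z| <= Normc.normc z.

Lemma cvg_rho (u : nat -> R[i]^o) (l : R[i]^o) :
  u @ \oo --> l -> (fun n => rho (u n)) @ \oo --> rho l.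
Proof.
move=> /cvgrPdist_lt ul; apply/cvgrPdist_lt => e e0.
have := ul e%:C; rewrite ltcR => /(_ e0); apply: filterS => n.
rewrite -raddfB; move=> h; apply: le_lt_trans (rho_le _) _.
by rewrite -ltcR.
Qed.

Lemma L_analytic_rho L a : analytic_at L a%:C ->
  real_analytic_at (fun x => rho (L x%:C)) a.
Proof.
move=> [e e0 [c hc]]; exists e => //; exists (fun k => rho (c k)) => x xe.
have := hc x%:C; rewrite -rmorphB normc_real => /(_ xe) /cvg_rho.
apply: cvg_trans; apply: near_eq_cvg; apply: nearW => n.
by rewrite raddf_sum; apply: eq_bigr => k _; rewrite -rmorphXn rhoZ.
Qed.

Lemma dirichlet_L_mellin chi L B :
  (forall n, `|\sum_(1 <= k < n) rho (chi k)| <= B) -> is_dirichlet_L chi L ->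
  forall s, 0 < s ->
  has_int (fun t => step_sum (rho \o chi) (1 / t) * t `^ (s - 1))
    (rho (L s%:C) / s).
Proof.
move=> wB [L_an L_ser].
set w := rho \o chi.
have Gex (s : R) : exists v : R, 0 < s ->
    has_int (fun t => step_sum w (1 / t) * t `^ (s - 1)) v /\
    (fun n => \sum_(1 <= k < n) w k * ((1 / k%:R) `^ s / s)) @ \oo --> v.
  have [s0|_] := ltP 0 s; last by exists 0.
  have [|v v1 v2] := @step_sum_mellin _ w B 1 s wB _ s0; last by exists v.
  by rewrite ltr01 lexx.
have [G GP] := choice Gex.
(* The identity theorem applies to this difference, which is zero for [x > 1] by comparison of the
   Dirichlet series. *)
pose h x := rho (L x%:C) - x * G x.
have h0 x : 0 < x -> h x = 0.
  apply: (@real_analytic_identity _ h 1) => [a a0|y y1].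
    apply: real_analytic_atB; first exact: L_analytic_rho.
    apply: real_analytic_at_idM.
    apply: (@mellin_analytic _ (fun t => step_sum w (1 / t)) G B) => //.
      by move=> s /GP[].
    by move=> t; exact: step_sum_le.
  have y0 : 0 < y by exact: lt_trans y1.
  apply/eqP; rewrite subr_eq0; apply/eqP.
  have [_ Gc] := GP _ y0.
  have : (fun n => y * \sum_(1 <= k < n) w k * ((1 / k%:R) `^ y / y))
      @ \oo --> y * G y by exact: cvgMr.
  move=> c2; have /cvg_rho c1 := L_ser y%:C y1.
  apply: cvg_unique c1 _ => //; apply: cvg_trans c2.
  apply: near_eq_cvg; apply: nearW => n.
  rewrite raddf_sum mulr_sumr; apply: eq_big_nat => k /andP[k0 _].
  rewrite natpowC_real// rhoZ /w /=.
  rewrite mulrCA; congr (_ * _).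
  rewrite mulrCA divff ?gt_eqF// mulr1 powRN div1r -powR_inv1 ?ler0n//.
  by rewrite -powRrM mulN1r powRN.
move=> s s0; have [sG _] := GP _ s0.
suff -> : rho (L s%:C) / s = G s by [].
by move: (h0 _ s0) => /eqP; rewrite subr_eq0 => /eqP ->; rewrite mulrAC divff ?mul1r// gt_eqF.
Qed.

End RealAxis.

(** * Nonvanishing to the right of 1 by sieving *)

Section RightOfOne.
Variable R : realType.
Implicit Types (a : nat -> R[i]) (s x M : R).

(* From (x / (x + 1))^(1-s) >= 1 + (s - 1) / (x + 1), by convexity of [expR]. *)
Lemma powR_telescope s x : 0 < x -> 1 < s ->
  (s - 1) * (x + 1) `^ (- s) <= x `^ (1 - s) - (x + 1) `^ (1 - s).
Proof.
move=> x0 s1.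
have y0 : 0 < x + 1 by rewrite addr_gt0.
have -> : x `^ (1 - s) = (x + 1) `^ (1 - s) * expR ((1 - s) * ln (x / (x + 1))).
  rewrite -{1}(divfK (lt0r_neq0 y0) x) powRM ?divr_ge0 1?ltW// mulrC.
  by rewrite {2}/powR gt_eqF// divr_gt0.
have -> : (x + 1) `^ (- s) = (x + 1) `^ (1 - s) / (x + 1).
  rewrite [1 - s]addrC (@powRD _ _ (- s) 1); last by rewrite (gt_eqF y0) implybT.
  by rewrite powRr1 ?ltW// mulfK// gt_eqF.
have z0 : 0 < (x + 1) `^ (1 - s) by rewrite powR_gt0.
have lnb : ln (x / (x + 1)) <= - (x + 1)^-1.
  have -> : x / (x + 1) = 1 + - (x + 1)^-1 by field; rewrite gt_eqF.
  by apply: le_ln1Dx; rewrite ltrN2 invf_lt1// ltrDr.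
have E : 1 + (s - 1) / (x + 1) <= expR ((1 - s) * ln (x / (x + 1))).
  apply: le_trans (expR_ge1Dx _); rewrite lerD2l.
  have -> : (s - 1) / (x + 1) = (1 - s) * - (x + 1)^-1 by ring.
  by rewrite ler_nM2l// subr_lt0.
rewrite mulrCA -[X in _ <= _ - X]mulr1 -mulrBr ler_pM2l// lerBrDl//.
Qed.

(** The bounds of [powR_telescope] telescope; the induction keeps the negative end term, which is
    dropped only at the end. *)
Lemma sum_powRN_le s (k n : nat) : 1 < s -> (0 < k)%N ->
  \sum_(k.+1 <= m < n) m%:R `^ (- s) <= k%:R `^ (1 - s) / (s - 1).
Proof.
move=> s1 k0.
have s10 : 0 < s - 1 by rewrite subr_gt0.
have H d : \sum_(k.+1 <= m < k.+1 + d) m%:R `^ (- s)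
    <= (k%:R `^ (1 - s) - (k + d)%:R `^ (1 - s)) / (s - 1).
  elim: d => [|d IH]; first by rewrite addn0 addn0 big_geq// subrr mul0r.
  rewrite addnS big_nat_recr/=; last by rewrite leq_addr.
  apply: (le_trans (lerD IH (lexx _))).
  rewrite ler_pdivlMr// mulrDl divfK ?gt_eqF//.
  have kd : 0 < (k + d)%:R :> R by rewrite ltr0n addn_gt0 k0.
  have := powR_telescope kd s1.
  rewrite addSn addnS -natr1; lra.
have [nk|/ltnW kn] := leqP n k.+1.
  by rewrite big_geq// divr_ge0 ?powR_ge0// ltW.
rewrite -(subnKC kn); apply: (le_trans (H _)).
by rewrite ler_pM2r ?invr_gt0// gerBl powR_ge0.
Qed.

Lemma powRN_small s e : 1 < s -> 0 < e -> exists2 k : nat, (0 < k)%N &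
  k%:R `^ (1 - s) < e.
Proof.
(* [b] solves [b^(1 - s) = e], and any [k > b] will do since [1 - s < 0]. *)
move=> s1 e0; set b := expR (ln e / (1 - s)).
exists (Num.truncn b).+1 => //.
have bk : b < (Num.truncn b).+1%:R by exact: truncnS_gt.
rewrite /powR gt_eqF ?ltr0n// -[X in _ < X](lnK e0) ltr_expR.
rewrite mulrC -ltr_ndivrMr ?subr_lt0//.
by rewrite -[X in X < _]expRK ltr_ln// posrE ?expR_gt0// ltr0n.
Qed.

(** These integers survive the sieve by the primes below [k]. *)
Definition rough (k n : nat) : bool :=
  all (fun p => prime p ==> ~~ (p %| n)%N) (iota 0 k).

Lemma roughS k n : rough k.+1 n = rough k n && (prime k ==> ~~ (k %| n)%N).
Proof. by rewrite /rough -addn1 iotaD all_cat /= andbT. Qed.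

Lemma rough_prime_mul k n : prime k -> rough k (k * n) = rough k n.
Proof.
move=> kp; apply: eq_in_all => p; rewrite mem_iota => /andP[_ pk].
case: (boolP (prime p)) => //= pp; rewrite Euclid_dvdM// dvdn_prime2//.
by rewrite ltn_eqF.
Qed.

Lemma rough_lt k n : (1 < n)%N -> (n < k)%N -> rough k n = false.
Proof.
move=> n1 nk; apply/negbTE/allPn; exists (pdiv n).
  by rewrite mem_iota/= add0n (leq_ltn_trans (pdiv_leq (ltnW n1))).
by rewrite pdiv_prime// pdiv_dvd.
Qed.

Lemma rough1 k : rough k 1.
Proof.
by apply/allP => p _; apply/implyP => pp; rewrite dvdn1 gtn_eqF// prime_gt1.
Qed.

(** The index starts at 0, with a zero term there, so that the multiples of [k] in the range are the
    [k * j] with [j] counted from 0. *)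
Definition rough_sum a (k n : nat) : R[i] :=
  \sum_(0 <= m < n) (if (0 < m)%N && rough k m then a m else 0).

(** [(n + k.-1) %/ k] is the ceiling of [n / k], which counts the multiples of [k] in [[0, n)]. *)
Lemma sum_dvdn (F : nat -> R[i]) k n : (0 < k)%N ->
  \sum_(0 <= m < n | (k %| m)%N) F m =
  \sum_(0 <= j < (n + k.-1) %/ k) F (k * j)%N.
Proof.
move=> k0; elim: n => [|n IH].
  by rewrite add0n divn_small ?prednK// !big_geq.
rewrite addSn divnS// -addnS prednK// dvdn_addl// big_mkcond/=.
rewrite big_nat_recr//= -big_mkcond/= IH.
case: (boolP (k %| n)%N) => [/dvdnP[q nq]|_]; last by rewrite addr0 add0n.
have -> : ((n + k.-1) %/ k = q)%N.
  by rewrite nq divnMDl// [(k.-1 %/ k)%N]divn_small ?addn0// prednK.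
by rewrite add1n big_nat_recr//= nq mulnC.
Qed.

(** Sieving by the prime [k] removes the terms at [k * j]. Such a product has a prime factor below
    [k] exactly when [j] has one, and multiplicativity pulls out [a k]. *)
Lemma rough_sumS a k n : (forall i j, (0 < i)%N -> (0 < j)%N -> a (i * j)%N = a i * a j) ->
  prime k -> rough_sum a k.+1 n =
    rough_sum a k n - a k * rough_sum a k ((n + k.-1) %/ k).
Proof.
move=> aM kp; have k0 := prime_gt0 kp.
rewrite mulr_sumr.
under [X in _ - X]eq_bigr => j _.
  rewrite (_ : a k * _ = if (0 < k * j)%N && rough k (k * j) then a (k * j)%N else 0).
    over.
  rewrite muln_gt0 k0/= rough_prime_mul//; case: ifP => [/andP[j0 _]|_].
    by rewrite aM.
  by rewrite mulr0.
rewrite -(sum_dvdn (fun m => if (0 < m)%N && rough k m then a m else 0))//.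
rewrite [X in _ - X]big_mkcond/= -sumrB; apply: eq_bigr => m _.
rewrite roughS kp/= andbA; case: (k %| m)%N => /=; first by rewrite andbF subrr.
by rewrite andbT subr0.
Qed.

Lemma cvg0_subZ (K : numFieldType) (V : normedModType K) (u v : nat -> V) (k : K) :
  u @ \oo --> 0 -> v @ \oo --> 0 -> (fun n => u n - k *: v n) @ \oo --> 0.
Proof.
move=> u0 v0; rewrite -[X in _ --> X](subr0 0) -[X in _ --> _ - X](scaler0 _ k).
by apply: cvgB => //; exact: cvgZr.
Qed.

(** Each prime [p] multiplies the limit by an Euler factor [1 - a p], so a zero limit remains zero
    at every stage of the sieve. *)
Lemma rough_sum_cvg0 a : (forall i j, (0 < i)%N -> (0 < j)%N -> a (i * j)%N = a i * a j) ->
  (fun n => \sum_(1 <= m < n) a m : R[i]^o) @ \oo --> (0 : R[i]^o) ->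
  forall k, (rough_sum a k : nat -> R[i]^o) @ \oo --> (0 : R[i]^o).
Proof.
move=> aM a0; elim=> [|k IH].
  rewrite -cvg_shiftS /=; move: a0; rewrite -cvg_shiftS.
  apply: cvg_trans; apply: near_eq_cvg; apply: nearW => n /=.
  rewrite big_add1/= /rough_sum big_nat_recl// add0r.
  by apply: eq_bigr.
have [kp|knp] := boolP (prime k); last first.
  apply: cvg_trans IH; apply: near_eq_cvg; apply: nearW => n /=.
  apply: eq_bigr => m _.
  by rewrite roughS (negbTE knp) andbT.
have k0 := prime_gt0 kp.
rewrite (_ : rough_sum a k.+1 = fun n =>
    rough_sum a k n - a k * rough_sum a k ((n + k.-1) %/ k)); last first.
  by apply/funext => n; exact: rough_sumS.
have up : (fun n => (n + k.-1) %/ k)%N @ \oo --> \oo.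
  apply/cvgnyPge => A; exists (A * k)%N => // n /= An.
  by rewrite leq_divRL// (leq_trans An)// leq_addr.
have c2 : (fun n => rough_sum a k ((n + k.-1) %/ k) : R[i]^o) @ \oo --> (0 : R[i]^o).
  exact: (cvg_comp _ _ up IH).
exact: (@cvg0_subZ _ R[i]^o _ _ (a k) IH c2).
Qed.

(** If the sum were 0, all sieved sums would tend to 0. But sieving by the primes up to [k] leaves 1
    plus terms with [m > k], of total modulus at most [M k^(1 - s) / (s - 1) <= 1/2] for large
    [k]. *)
Lemma multiplicative_series_neq0 a M s (l : R[i]) : a 1%N = 1 ->
  (forall i j, (0 < i)%N -> (0 < j)%N -> a (i * j)%N = a i * a j) -> 1 < s ->
  (forall k, Normc.normc (a k) <= M * k%:R `^ (- s)) ->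
  (fun n => \sum_(1 <= m < n) a m : R[i]^o) @ \oo --> (l : R[i]^o) -> l <> 0.
Proof.
move=> a1 aM s1 aB al l0; rewrite {}l0 in al.
have M0 : 0 <= M.
  by have := aB 1%N; rewrite a1 Normc.normc1 powR1 mulr1 => /(le_trans ler01).
have s10 : 0 < s - 1 by rewrite subr_gt0.
(* The threshold makes the tail at most 1/2; [M + 1] keeps the denominator positive. *)
have [|k k0 kM] := @powRN_small s ((s - 1) / (2 * (M + 1))) s1.
  by rewrite divr_gt0// mulr_gt0// ltr_wpDl.
have /cvgrPdist_lt/(_ (2^-1)%:C) := rough_sum_cvg0 aM al k.+1.
rewrite ltcR invr_gt0 ltr0n => /(_ isT) [n0 _ /(_ (n0 + 2)%N)] /=.
rewrite leq_addr sub0r normrN => /(_ isT).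
set T := rough_sum a k.+1 (n0 + 2) => T2.
have {}T2 : Normc.normc T < 2^-1 by rewrite -ltcR.
have ET : T = 1 + \sum_(2 <= m < n0 + 2) (if rough k.+1 m then a m else 0).
  rewrite /T /rough_sum addn2 big_nat_recl// add0r big_nat_recl//= rough1 a1.
  rewrite 2!big_add1/=; congr (_ + _); apply: eq_bigr => //.
have nsum (F : nat -> R[i]) u v :
    Normc.normc (\sum_(u <= m < v) F m) <= \sum_(u <= m < v) Normc.normc (F m).
  elim/big_rec2: _ => [|i y1 y2 _ le]; first by rewrite Normc.normc0.
  by apply: (le_trans (le_normcD _ _)); rewrite lerD2l.
have T1 : Normc.normc (T - 1) <= M * (k%:R `^ (1 - s) / (s - 1)).
  rewrite ET addrAC subrr add0r; apply: (le_trans (nsum _ _ _)).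
  apply: (@le_trans _ _ (M * \sum_(k.+1 <= m < n0 + 2) m%:R `^ (- s))); last first.
    by rewrite ler_wpM2l// sum_powRN_le.
  rewrite mulr_sumr.
  (* Every integer from 2 to [k] has a prime factor at most [k], so it has been sieved out. *)
  apply: (@le_trans _ _ (\sum_(2 <= m < n0 + 2 | (k < m)%N) M * m%:R `^ (- s))).
    rewrite [leRHS]big_mkcond/=; rewrite big_nat [leRHS]big_nat.
    apply: ler_sum => m /andP[m1 _]; case: (ltnP k m) => km.
      by case: ifP => // _; rewrite Normc.normc0 mulr_ge0// powR_ge0.
    by rewrite rough_lt// Normc.normc0.
  by rewrite [leRHS](big_nat_widenl _ 2).
have : Normc.normc (1 : R[i]) <= Normc.normc T + Normc.normc (T - 1).
  rewrite -[Normc.normc (T - 1)]normcN; apply: le_trans (le_normcD _ _).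
  by rewrite opprB addrCA subrr addr0.
rewrite Normc.normc1.
have : M * (k%:R `^ (1 - s) / (s - 1)) <= 2^-1.
  rewrite mulrA ler_pdivrMr//.
  have M1 : 0 < M + 1 by rewrite ltr_wpDl.
  move: kM; rewrite ltr_pdivlMr ?mulr_gt0//.
  have := powR_ge0 k%:R (1 - s); nra.
lra.
Qed.

Lemma dirichlet_L_neq0_gt1 N (chi : nat -> R[i]) L s :
  dirichlet_character N chi -> is_dirichlet_L chi L -> 1 < s -> L s%:C <> 0.
Proof.
move=> [N0 chi1 chiM chiN _] [_ L_ser] s1.
have chi_mod := periodic_modn chiN.
(* By periodicity, the moduli over one period sum to a bound for [chi]. *)
pose M := \sum_(i < N) Normc.normc (chi i).
have chiB n : Normc.normc (chi n) <= M.
  have lt : (n %% N < N)%N by rewrite ltn_mod.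
  rewrite chi_mod /M (bigD1 (Ordinal lt))//= lerDl sumr_ge0// => i _.
  by case: (chi i) => x y /=; exact: sqrtr_ge0.
pose a (k : nat) : R[i] := chi k * (k%:R `^ (- s))%:C.
apply: (@multiplicative_series_neq0 a M s) => //.
- by rewrite /a chi1 mul1r powR1.
- move=> i j i0 j0; rewrite /a chiM natrM powRM ?ler0n// rmorphM/= mulrACA//.
- move=> k; rewrite Normc.normcM normc_real ger0_norm ?powR_ge0//.
  by apply: ler_wpM2r => //; exact: powR_ge0.
have := L_ser s%:C s1.
apply: cvg_trans; apply: near_eq_cvg; apply: nearW => n /=.
by apply: eq_big_nat => k /andP[k0 _]; rewrite natpowC_real.
Qed.

End RightOfOne.

(** * Lower bound for the distance at a real zero of L *)

Section DistanceLowerBound.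
Variables (R : realType) (chi : nat -> R[i]) (B : R) (r s : R).
Hypothesis ReB : forall n, `|\sum_(1 <= k < n) complex.Re (chi k)| <= B.
Hypothesis ImB : forall n, `|\sum_(1 <= k < n) complex.Im (chi k)| <= B.
Hypotheses (rs : r < s) (s_gt0 : 0 < s) (s_gt2r : 0 < 1 - 2 * r + s).

Let S1 := step_sum (@complex.Re R \o chi).
Let S2 := step_sum (@complex.Im R \o chi).

(** By [dirichlet_L_mellin] these integrals are the real and imaginary parts of [L(s) / s], so the
    two hypotheses express [L(s) = 0]. *)
Hypothesis S1_0 : has_int (fun t => S1 (1 / t) * t `^ (s - 1)) 0.
Hypothesis S2_0 : has_int (fun t => S2 (1 / t) * t `^ (s - 1)) 0.

Let D : set R := `]0%R, 1%R[.

Lemma char_sumE x : char_sum chi x = S1 x +i* S2 x.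
Proof.
rewrite /char_sum /S1 /S2 /step_sum.
by elim/big_rec3: _ => // i y1 y2 z _ ->; rewrite /comp; case: (chi i).
Qed.

(** At exponent 1 the Mellin weight is [t^0 = 1], so measurability is a by-product of
    integrability. *)
Lemma measurable_step_sum w alpha : (forall n, `|\sum_(1 <= k < n) w k| <= B) ->
  0 < alpha <= 1 -> measurable_fun D (fun t : R => step_sum w (alpha / t)).
Proof.
move=> wB a01; have [v hv _] := step_sum_mellin wB a01 ltr01.
apply: (@has_int_measurable _ _ v).
by apply: eq_has_int hv => t _; rewrite subrr powRr0 mulr1.
Qed.

(** The squared modulus is bounded below by an expression linear in the step sums, whose integrals
    against [t^(s - 1)] vanish; what remains is [2 lam / d - lam^2 / (2 b)]. *)
Lemma dist_integral_ge (l : nat) (c : 'I_l -> R[i]) (alpha : 'I_l -> R) :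
  (forall j, 0 < alpha j <= 1) ->
  ((2 * (s - r) / (1 - 2 * r + s) ^+ 2)%:E <=
    \int[@lebesgue_measure R]_(t in D) (dist_integrand chi r c alpha t)%:E)%E.
Proof.
move=> a01.
pose A j t := complex.Re (c j) * S1 (alpha j / t) - complex.Im (c j) * S2 (alpha j / t).
pose A' j t := complex.Re (c j) * S2 (alpha j / t) + complex.Im (c j) * S1 (alpha j / t).
pose p t := t `^ (1 - r) - t `^ r * \sum_j A j t.
pose q t := - (t `^ r * \sum_j A' j t).
have integrandE t : dist_integrand chi r c alpha t = (p t ^+ 2 + q t ^+ 2) / t.
  rewrite /dist_integrand.
  have -> : (t `^ (1 - r))%:C - (t `^ r)%:C * \sum_(j < l) c j * char_sum chi (alpha j / t)
      = p t +i* q t.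
    have -> : \sum_(j < l) c j * char_sum chi (alpha j / t) =
        (\sum_j A j t) +i* (\sum_j A' j t).
      elim/big_rec3: _ => // i y1 y2 z _ ->; rewrite char_sumE /A /A'.
      by case: (c i) => u v.
    by apply/eqP; rewrite eq_complex /p /q /= mul0r mul0r subr0 addr0 sub0r !eqxx.
  by rewrite /= sqr_sqrtr// addr_ge0// sqr_ge0.
have mS1 j : measurable_fun D (fun t => S1 (alpha j / t)) by exact: measurable_step_sum.
have mS2 j : measurable_fun D (fun t => S2 (alpha j / t)) by exact: measurable_step_sum.
have mpow e : measurable_fun D (fun t : R => t `^ e).
  by apply: (@measurable_funS _ _ _ _ setT) => //; exact: measurable_powR.
have mp : measurable_fun D p.
  apply: measurable_funB => //; apply: measurable_funM => //.
  apply: measurable_sum => j.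
  by apply: measurable_funB; apply: measurable_funM.
have mq : measurable_fun D q.
  apply: measurable_funN; apply: measurable_funM => //.
  apply: measurable_sum => j.
  by apply: measurable_funD; apply: measurable_funM.
pose b := s - r; pose d := 1 - 2 * r + s.
have b0 : 0 < b by rewrite subr_gt0.
(* This value maximizes [2 lam / d - lam^2 / (2 b)], with maximum [2 b / d^2]. *)
pose lam := 2 * b / d.
pose g t := 2 * lam * (t `^ (d - 1) + \sum_j (- complex.Re (c j) *
    (S1 (alpha j / t) * t `^ (s - 1)) + complex.Im (c j) * (S2 (alpha j / t) * t `^ (s - 1))))
  + - lam ^+ 2 * t `^ (2 * b - 1).
have hg : has_int g (2 * b / d ^+ 2).
  have -> : 2 * b / d ^+ 2 = 2 * lam * (d^-1 + \sum_(j < l) 0) + - lam ^+ 2 * (2 * b)^-1.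
    rewrite big1// addr0 /lam; field.
    by rewrite !gt_eqF.
  apply: has_intD; apply: has_intZ; last first.
    by apply: has_int_powR1; rewrite mulr_gt0.
  apply: has_intD; first exact: has_int_powR1.
  apply: has_int_sum => j.
  have -> : 0 = - complex.Re (c j) * (alpha j `^ s * 0) + complex.Im (c j) * (alpha j `^ s * 0).
    by rewrite !mulr0 addr0.
  by apply: has_intD; apply: has_intZ; apply: step_sum_mellin_scale.
apply: (has_int_ge_lbound hg).
- apply: (@eq_measurable_fun _ _ _ _ D (fun t => (p t ^+ 2 + q t ^+ 2) * t `^ (-1))).
    move=> t; rewrite inE /D /= in_itv/= => /andP[t0 _].
    by rewrite integrandE powR_inv1// ltW.
  by apply: measurable_funM => //; apply: measurable_funD; apply: measurable_funX.
- by move=> t /andP[t0 _]; rewrite integrandE divr_ge0 ?addr_ge0 ?sqr_ge0// ltW.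
move=> t /andP[t0 _]; rewrite integrandE ler_pdivlMr//.
pose u := t `^ b.
have pw x y : t `^ (x + y) = t `^ x * t `^ y.
  by rewrite powRD// (gt_eqF t0) implybT.
have pwB x : t `^ (x - 1) * t = t `^ x.
  by rewrite pw powR_inv1 ?ltW// mulfVK// gt_eqF.
have -> : g t * t = 2 * lam * p t * u - lam ^+ 2 * u ^+ 2.
  have -> : g t * t = 2 * lam * (t `^ (d - 1) * t - (\sum_j A j t) * (t `^ (s - 1) * t))
      - lam ^+ 2 * (t `^ (2 * b - 1) * t).
    rewrite /g; set X := \sum_j (_ + _).
    have -> : X = - (\sum_j A j t) * t `^ (s - 1).
      by rewrite -sumrN mulr_suml; apply: eq_bigr => j _; rewrite /A; ring.
    ring.
  rewrite !pwB /p /u.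
  have -> : d = (1 - r) + b by rewrite /d /b; ring.
  have -> : t `^ s = t `^ r * t `^ b by rewrite -pw /b; congr (_ `^ _); ring.
  have -> : t `^ (2 * b) = t `^ b ^+ 2 by rewrite expr2 -pw; congr (_ `^ _); ring.
  rewrite pw; ring.
(* |f|^2 >= 2 lam Re(f) u - lam^2 u^2, where lam u is the projection of f on u. *)
have := sqr_ge0 (p t - lam * u); have := sqr_ge0 (q t); nra.
Qed.

End DistanceLowerBound.

(** * The zero-free interval on the real axis *)

Theorem theorem4 (R : realType) (N q : nat) (chi : nat -> R[i])
    (L : R[i] -> R[i])
    (chi_char : dirichlet_character N chi)
    (chi_nontrivial : ~ principal N chi)
    (chi_conductor : has_conductor N chi q)
    (L_chi : is_dirichlet_L chi L) :
  forall C r : R, 2^-1 <= r < 1 ->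
  (dist_sq chi r <=
     (1 / (2 - 2 * r)
      - C ^+ 2 / (2 * (ln q%:R) ^+ 2 * (1 - r) ^+ 3))%:E)%E ->
  forall sigma : R, 1 - C / ln q%:R < sigma -> L sigma%:C <> 0.
Proof.
move=> C r /andP[r2 r1] hd s sC.
have [s1|s1] := ltP 1 s; first exact: dirichlet_L_neq0_gt1 chi_char L_chi s1.
set d := C / ln q%:R in sC.
have d0 : 1 - s < d by lra.
have a0 : 0 < 1 - r by rewrite subr_gt0.
(* [C] and [q] enter the bound only through [d]; for [ln q = 0] the convention [x / 0 = 0] keeps the
   identity true. *)
have bndE : 1 / (2 - 2 * r) - C ^+ 2 / (2 * (ln q%:R) ^+ 2 * (1 - r) ^+ 3) =
    1 / (2 * (1 - r)) - d ^+ 2 / (2 * (1 - r) ^+ 3).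
  have -> : 2 - 2 * r = 2 * (1 - r) by ring.
  congr (_ - _); rewrite /d expr_div_n !invfM; ring.
rewrite {}bndE in hd.
have s1r0 : 0 <= 1 - s by rewrite subr_ge0.
(* Solved for [d^2], the assumed bound can be tested on any lower bound [x] of the squared
   distance. *)
have lt_bnd x : x <= 1 / (2 * (1 - r)) - d ^+ 2 / (2 * (1 - r) ^+ 3) ->
   d ^+ 2 <= (1 - r) ^+ 2 * (1 - 2 * (1 - r) * x).
  move=> xb.
  have -> : (1 - r) ^+ 2 * (1 - 2 * (1 - r) * x) =
     2 * (1 - r) ^+ 3 * (1 / (2 * (1 - r)) - x) by field; rewrite gt_eqF.
  have -> : d ^+ 2 = 2 * (1 - r) ^+ 3 * (d ^+ 2 / (2 * (1 - r) ^+ 3)).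
    by field; rewrite gt_eqF.
  rewrite ler_pM2l; last by rewrite mulr_gt0// exprn_gt0.
  by rewrite lerBrDl addrC -lerBrDl; lra.
(* For [s <= r] the trivial lower bound 0 already gives [d <= 1 - r <= 1 - s], a contradiction. *)
have [sr|rs] := leP s r.
  have : (0 <= dist_sq chi r)%E.
    apply: le_ereal_inf_tmp => _ [l [c [al [_ ->]]]].
    apply: integral_ge0 => t; rewrite /= in_itv/= => /andP[t0 _].
    by rewrite lee_fin /dist_integrand divr_ge0 ?sqr_ge0// ltW.
  move=> /le_trans /(_ hd); rewrite lee_fin => /(lt_bnd 0).
  rewrite mulr0 subr0 mulr1 => dr; exfalso; nra.
move=> L0.
have s0 : 0 < s by apply: lt_trans rs; apply: lt_le_trans r2; rewrite invr_gt0.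
have [N0 _ _ chiN _] := chi_char.
have sum0 := dirichlet_character_sum0 chi_char chi_nontrivial.
have [B1 hB1] : exists B, forall n, `|\sum_(1 <= k < n) complex.Re (chi k)| <= B.
  apply: (periodic_sum_bounded N0) => [n|]; first by rewrite chiN.
  by rewrite -raddf_sum sum0.
have [B2 hB2] : exists B, forall n, `|\sum_(1 <= k < n) complex.Im (chi k)| <= B.
  apply: (periodic_sum_bounded N0) => [n|]; first by rewrite chiN.
  by rewrite -raddf_sum sum0.
pose B := Num.max B1 B2.
have ReB n : `|\sum_(1 <= k < n) complex.Re (chi k)| <= B by rewrite le_max hB1.
have ImB n : `|\sum_(1 <= k < n) complex.Im (chi k)| <= B by rewrite le_max hB2 orbT.
have ReZ (z : R[i]) x : complex.Re (z * x%:C) = complex.Re z * x.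
  by case: z => u v /=; rewrite mulr0 subr0.
have ImZ (z : R[i]) x : complex.Im (z * x%:C) = complex.Im z * x.
  by case: z => u v /=; rewrite mulr0 add0r.
have Re_le (z : R[i]) : `|complex.Re z| <= Normc.normc z.
  by case: z => u v /=; rewrite -sqrtr_sqr ler_wsqrtr// lerDl sqr_ge0.
have Im_le (z : R[i]) : `|complex.Im z| <= Normc.normc z.
  by case: z => u v /=; rewrite -sqrtr_sqr ler_wsqrtr// lerDr sqr_ge0.
have := @dirichlet_L_mellin R (@complex.Re R) ReZ Re_le _ _ _ ReB L_chi s s0.
have := @dirichlet_L_mellin R (@complex.Im R) ImZ Im_le _ _ _ ImB L_chi s s0.
rewrite L0 /= mul0r => S2_0 S1_0.
have e0 : 0 < 1 - 2 * r + s by lra.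
have : ((2 * (s - r) / (1 - 2 * r + s) ^+ 2)%:E <= dist_sq chi r)%E.
  apply: le_ereal_inf_tmp => _ [l [c [al [al01 ->]]]].
  exact: dist_integral_ge ReB ImB rs s0 e0 S1_0 S2_0 _ _ _ al01.
move=> /le_trans /(_ hd); rewrite lee_fin => /lt_bnd.
set x := _ / _.
(* With [a = 1 - r] and [b = s - r] this rests on [(a + b)^2 - 4 a b = (a - b)^2 = (1 - s)^2]. *)
have -> : (1 - r) ^+ 2 * (1 - 2 * (1 - r) * x) =
    ((1 - r) * (1 - s) / (1 - 2 * r + s)) ^+ 2.
  by rewrite /x; field; rewrite gt_eqF.
apply/negP; rewrite -ltNge ltr_sqr ?nnegrE; last 2 first.
- exact: divr_ge0 (mulr_ge0 (ltW a0) s1r0) (ltW e0).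
- exact: le_trans s1r0 (ltW d0).
(* Since [s > r] gives [1 - 2 r + s > 1 - r], the quotient is at most [1 - s < d]. *)
rewrite ltr_pdivrMr//; nra.
Qed.
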